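(* Let $v,w\in S_n$ be such that there are no unexpected zeros. Then $\nu(G_{v,w})=|P_v|$.
   Context: A permutation $v\in S_n$ is identified with the permutation matrix having $1$s at $(v(j),j)$. $D^\circ(v)=\{(i,j): v(j)<i,\ v^{-1}(i)>j\}$ is the opposite Rothe diagram. $\le$ is the Bruhat order and $t_{a,b}$ the transposition of $a$ and $b$. An unexpected zero for $(v,w)$ is an $(i,j)\in D^\circ(v)$ such that $t_{v(j),i}\,v\not\le w$. The directed graph $G_{v,w}$ has vertex set $[n]$ and edges $v(j)\to i$ for all $(i,j)\in D^\circ(v)$ with $t_{v(j),i}\,v\le w$. For a graph $G$, the cyclomatic number is $\nu(G)=|E(G)|-|V(G)|+\#(\text{connected components of }G)$ (connected components of the underlying undirected graph). For $(i,j),(k,l)\in D^\circ(v)$ with $i<k$ and $j<l$ put $d((i,j),(k,l))=(k-i)+(l-j)$. The set $P_v\subseteq D^\circ(v)\times D^\circ(v)$ is defined recursively by increasing distance $d$: (i) $((i,j),(i+1,j+1))\in P_v$ whenever $(i,j),(i+1,j+1)\in D^\circ(v)$; (ii) a pair $((i,j),(k,l))$ of elements of $D^\circ(v)$ with $i<k$, $j<l$ and $d((i,j),(k,l))=d$ is in $P_v$ if there is not already some $((i,j),(k',l'))\in P_v$ with $d((i,j),(k',l'))<d$ or some $((i',j'),(k,l))\in P_v$ with $d((i',j'),(k,l))<d$. *)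

(* Defs.v *)
From mathcomp Require Import all_boot fingroup perm ssralg ssrint.

Set Implicit Arguments.
Unset Strict Implicit.
Unset Printing Implicit Defensive.

(* The indices 1, ..., n are shifted to 0, ..., n - 1 (the type 'I_n).
   In MathComp (s * t) x = t (s x) for permutations, so the product t_{a,b} v
   (first v, then t_{a,b}) is written  v * tperm a b. *)

Definition tmul n (a b : 'I_n) (v : 'S_n) : 'S_n := (v * tperm a b)%g.

Definition perm_len n (v : 'S_n) : nat :=
  #|[set p : 'I_n * 'I_n | (p.1 < p.2) && (v p.2 < v p.1)]|.

Definition bruhat_step n : rel 'S_n := fun u u' =>
  [exists a : 'I_n, exists b : 'I_n, (u' == tmul a b u) && (perm_len u < perm_len u')].

Definition bruhat n : rel 'S_n := connect (@bruhat_step n).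

(* A cell (i, j) is in row i and column j. *)
Definition opRothe n (v : 'S_n) : {set 'I_n * 'I_n} :=
  [set c : 'I_n * 'I_n | (v c.2 < c.1) && (c.2 < (v^-1)%g c.1)].

Definition unexpected_zero n (v w : 'S_n) (c : 'I_n * 'I_n) : bool :=
  (c \in opRothe v) && ~~ bruhat (tmul (v c.2) c.1 v) w.

Definition graph_vw n (v w : 'S_n) : rel 'I_n := fun a b =>
  [exists c : 'I_n * 'I_n in opRothe v,
    [&& a == v c.2, b == c.1 & bruhat (tmul (v c.2) c.1 v) w]].

Definition underlying (V : finType) (e : rel V) : rel V :=
  fun x y => e x y || e y x.

(* Int-valued, so that the subtraction is not truncated. *)
Definition cyclomatic (V : finType) (e : rel V) : int :=
  (#|[set p : V * V | e p.1 p.2]|%:Z - #|V|%:Z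
     + (n_comp (underlying e) V)%:Z)%R.

Definition cell_dist n (c c' : 'I_n * 'I_n) : nat :=
  (c'.1 - c.1) + (c'.2 - c.2).

Definition se_pair n (v : 'S_n) (p : ('I_n * 'I_n) * ('I_n * 'I_n)) : bool :=
  [&& p.1 \in opRothe v, p.2 \in opRothe v, p.1.1 < p.2.1 & p.1.2 < p.2.2].

(* The pairs of P_v at distance < d. *)
Fixpoint Pv_lt n (v : 'S_n) (d : nat) : {set ('I_n * 'I_n) * ('I_n * 'I_n)} :=
  if d is d'.+1 then
    Pv_lt v d' :|:
    [set p : ('I_n * 'I_n) * ('I_n * 'I_n) | [&& se_pair v p, cell_dist p.1 p.2 == d' &
       ((p.2.1 == p.1.1.+1 :> nat) && (p.2.2 == p.1.2.+1 :> nat))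
       || ~~ [exists q in Pv_lt v d', (q.1 == p.1) || (q.2 == p.2)]]]
  else set0.

(* All distances are < n + n, so the recursion is complete at that stage. *)
Definition Pv n (v : 'S_n) : {set ('I_n * 'I_n) * ('I_n * 'I_n)} :=
  Pv_lt v (n + n).

(* Main.v *)
Require Import Defs.
From mathcomp Require Import all_boot fingroup perm ssralg ssrint.
From mathcomp Require Import zify.

Set Implicit Arguments.
Unset Strict Implicit.
Unset Printing Implicit Defensive.

(* Add the dots (v(j), j) to the diagram D. Within this augmented diagram, each
   cell of D has a next cell to its right and a next cell above it.  The pairs
   of P_v are exactly the pairs (W e, S e), where W e and S e are the cells
   immediately to the left of e and immediately below e in the augmented
   diagram, whenever both exist.  Each row contains exactly one e without W e,
   each column exactly one e without S e; since the augmented diagram has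
   |D| + n cells, |P_v| = |D| - n + #{e without W e and S e}.  The latter cells
   correspond to the decompositions of v as a skew sum, which in turn correspond
   to the connected components of the graph of noninversions of v. *)

(** * The augmented diagram, its corners and neighbouring cells *)

Definition augRothe n (v : 'S_n) : {set 'I_n * 'I_n} :=
  [set e : 'I_n * 'I_n | (v e.2 <= e.1) && (e.2 <= (v^-1)%g e.1)].

Definition has_west n (v : 'S_n) (e : 'I_n * 'I_n) : bool :=
  [exists j : 'I_n, (j < e.2) && ((e.1, j) \in augRothe v)].

Definition has_south n (v : 'S_n) (e : 'I_n * 'I_n) : bool :=
  [exists k : 'I_n, (e.1 < k) && ((k, e.2) \in augRothe v)].

Definition corner n (p : ('I_n * 'I_n) * ('I_n * 'I_n)) : 'I_n * 'I_n :=
  (p.1.1, p.2.2).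

(** These are the pairs (W e, S e), with e = [corner p]. *)
Definition corner_pairs n (v : 'S_n) : {set ('I_n * 'I_n) * ('I_n * 'I_n)} :=
  [set p | [&& se_pair v p, corner p \in augRothe v,
    [forall l : 'I_n, (p.1.2 < l < p.2.2) ==> ((p.1.1, l) \notin augRothe v)] &
    [forall k : 'I_n, (p.1.1 < k < p.2.1) ==> ((k, p.2.2) \notin augRothe v)]]].

(** For n > 0 the trivial cut at 0 is included, while a cut at n is not in ['I_n]; hence there is
    one cut for each skew summand, at its first position. *)
Definition skew_cuts n (v : 'S_n) : {set 'I_n} :=
  [set l : 'I_n | [forall j : 'I_n, forall k : 'I_n, (j < l <= k) ==> (v k < v j)]].

(** This is why relaxing both strict inequalities of [opRothe] adds only the dots: equality in one
    forces equality in the other. Stated over naturals for [lia]. *)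
Lemma perm_val_eq n (v : 'S_n) (i j : 'I_n) :
  (nat_of_ord (v j) == i) = (nat_of_ord j == (v^-1)%g i).
Proof.
apply/idP/idP => /eqP /val_inj.
- by move=> <-; rewrite permK.
- by move=> ->; rewrite permKV.
Qed.

Lemma opRothe_aug n (v : 'S_n) (i j : 'I_n) :
  ((i, j) \in opRothe v) = ((i, j) \in augRothe v) && (v j != i :> nat).
Proof. by rewrite !inE /=; have := perm_val_eq v i j; lia. Qed.

(** The dot is the easternmost cell of its row, so a cell with another one to its east is not a dot.
    Likewise, in [aug_col], the dot is the northernmost cell of its column. *)
Lemma aug_row n (v : 'S_n) (i j l : 'I_n) :
  j < l -> (i, l) \in augRothe v ->
  ((i, j) \in augRothe v) = ((i, j) \in opRothe v).
Proof. by rewrite !inE /=; have := perm_val_eq v i j; lia. Qed.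

Lemma aug_col n (v : 'S_n) (i k l : 'I_n) :
  i < k -> (i, l) \in augRothe v ->
  ((k, l) \in augRothe v) = ((k, l) \in opRothe v).
Proof. by rewrite !inE /=; have := perm_val_eq v k l; lia. Qed.

Lemma ord_least n (P : pred 'I_n) (x : 'I_n) : P x ->
  exists2 y : 'I_n, P y & forall z : 'I_n, P z -> y <= z.
Proof. by move=> Px; case: (arg_minnP (@nat_of_ord n) Px) => y; exists y. Qed.

Lemma ord_greatest n (P : pred 'I_n) (x : 'I_n) : P x ->
  exists2 y : 'I_n, P y & forall z : 'I_n, P z -> z <= y.
Proof. by move=> Px; case: (arg_maxnP (@nat_of_ord n) Px) => y; exists y. Qed.

(** The dot of row i lies strictly east of (i, j), so there is a nearest cell; it may be the dot
    itself. *)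
Lemma next_east n (v : 'S_n) (i j : 'I_n) : (i, j) \in opRothe v ->
  exists l : 'I_n, [/\ j < l, (i, l) \in augRothe v &
    forall l' : 'I_n, j < l' < l -> (i, l') \notin augRothe v].
Proof.
move=> Dc; have : (j < (v^-1)%g i) && ((i, (v^-1)%g i) \in augRothe v).
  by move: Dc; rewrite !inE /= permKV; lia.
case/(@ord_least n (fun l => (j < l) && ((i, l) \in augRothe v))) => l.
case/andP=> jl Dl minl; exists l; split=> // l' /andP[jl' l'l].
by apply/negP=> Dl'; have := minl l'; rewrite jl' Dl'; lia.
Qed.

Lemma next_north n (v : 'S_n) (k l : 'I_n) : (k, l) \in opRothe v ->
  exists i : 'I_n, [/\ i < k, (i, l) \in augRothe v &
    forall i' : 'I_n, i < i' < k -> (i', l) \notin augRothe v].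
Proof.
move=> Dc; have : (v l < k) && ((v l, l) \in augRothe v).
  by move: Dc; rewrite !inE /= permK; lia.
case/(@ord_greatest n (fun i => (i < k) && ((i, l) \in augRothe v))) => i.
case/andP=> ik Di maxi; exists i; split=> // i' /andP[ii' i'k].
by apply/negP=> Di'; have := maxi i'; rewrite i'k Di'; lia.
Qed.

Lemma next_west n (v : 'S_n) (i l : 'I_n) :
  (i, l) \in augRothe v -> has_west v (i, l) ->
  exists j : 'I_n, [/\ j < l, (i, j) \in opRothe v &
    forall l' : 'I_n, j < l' < l -> (i, l') \notin augRothe v].
Proof.
move=> De /existsP[j0].
case/(@ord_greatest n (fun j => (j < l) && ((i, j) \in augRothe v))) => j.
case/andP=> jl Dj maxj; exists j; split=> //; first by rewrite -(aug_row jl De).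
move=> l' /andP[jl' l'l].
by apply/negP=> Dl'; have := maxj l'; rewrite l'l Dl'; lia.
Qed.

Lemma next_south n (v : 'S_n) (i l : 'I_n) :
  (i, l) \in augRothe v -> has_south v (i, l) ->
  exists k : 'I_n, [/\ i < k, (k, l) \in opRothe v &
    forall k' : 'I_n, i < k' < k -> (k', l) \notin augRothe v].
Proof.
move=> De /existsP[k0].
case/(@ord_least n (fun k => (i < k) && ((k, l) \in augRothe v))) => k.
case/andP=> ik Dk mink; exists k; split=> //; first by rewrite -(aug_col ik De).
move=> k' /andP[ik' k'k].
by apply/negP=> Dk'; have := mink k'; rewrite ik' Dk'; lia.
Qed.

Lemma corner_pairsP n (v : 'S_n) (i j k l : 'I_n) :
  reflect
    [/\ [/\ (i, j) \in opRothe v, (k, l) \in opRothe v, i < k & j < l],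
        (i, l) \in augRothe v,
        forall l' : 'I_n, j < l' < l -> (i, l') \notin augRothe v &
        forall k' : 'I_n, i < k' < k -> (k', l) \notin augRothe v]
    (((i, j), (k, l)) \in corner_pairs v).
Proof.
rewrite [X in reflect _ X]inE; apply: (iffP and4P) => /=.
- case=> /and4P[/= D1 D2 ik jl] De /forallP W /forallP S; split=> //.
  + by move=> l' H; apply: (implyP (W l')).
  + by move=> k' H; apply: (implyP (S k')).
- case=> -[D1 D2 ik jl] De W S; split=> //; first exact/and4P.
  + by apply/forallP => l'; apply/implyP/W.
  + by apply/forallP => k'; apply/implyP/S.
Qed.

(** * Identification of P_v with the corner pairs *)

Lemma corner_pairs_fst n (v : 'S_n) : {in corner_pairs v &, injective fst}.
Proof.
case=> [[i j] [k l]] [[i' j'] [k' l']] /corner_pairsP[[_ Dc ik jl] De W S].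
move=> /corner_pairsP[[_ Dc' ik' jl'] De' W' S'] [? ?]; subst i' j'.
have ell : l = l'.
  apply: val_inj => /=; case: (ltngtP l l') => // lt.
  - by have := W' l; rewrite jl lt De => /(_ isT).
  - by have := W l'; rewrite jl' lt De' => /(_ isT).
subst l'; have -> // : k = k'.
have Ac : (k, l) \in augRothe v by rewrite (aug_col ik De).
have Ac' : (k', l) \in augRothe v by rewrite (aug_col ik' De).
apply: val_inj => /=; case: (ltngtP k k') => // lt.
- by have := S' k; rewrite ik lt Ac => /(_ isT).
- by have := S k'; rewrite ik' lt Ac' => /(_ isT).
Qed.

(** S e determines e, the next cell to its north, and e determines W e. Together with
    [corner_pairs_fst] this shows that corner pairs never block one another in the recursion for
    P_v. *)
Lemma corner_pairs_snd n (v : 'S_n) : {in corner_pairs v &, injective snd}.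
Proof.
case=> [[i j] [k l]] [[i' j'] [k' l']] /corner_pairsP[[Dc _ ik jl] De W S].
move=> /corner_pairsP[[Dc' _ ik' jl'] De' W' S'] [? ?]; subst k' l'.
have eii : i = i'.
  apply: val_inj => /=; case: (ltngtP i i') => // lt.
  - by have := S i'; rewrite ik' lt De' => /(_ isT).
  - by have := S' i; rewrite ik lt De => /(_ isT).
subst i'; have -> // : j = j'.
have Ac : (i, j) \in augRothe v by rewrite (aug_row jl De).
have Ac' : (i, j') \in augRothe v by rewrite (aug_row jl' De).
apply: val_inj => /=; case: (ltngtP j j') => // lt.
- by have := W j'; rewrite jl' lt Ac' => /(_ isT).
- by have := W' j; rewrite jl lt Ac => /(_ isT).
Qed.

Lemma corner_inj n (v : 'S_n) : {in corner_pairs v &, injective (@corner n)}.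
Proof.
case=> [[i j] [k l]] [[i' j'] [k' l']] Hp Hp' [? ?]; subst i' l'.
case/corner_pairsP: (Hp) => [[Dc _ ik jl] De W S].
case/corner_pairsP: (Hp') => [[Dc' _ ik' jl'] _ W' S'].
apply: (corner_pairs_fst Hp Hp') => /=; have -> // : j = j'.
have Ac : (i, j) \in augRothe v by rewrite (aug_row jl De).
have Ac' : (i, j') \in augRothe v by rewrite (aug_row jl' De).
apply: val_inj => /=; case: (ltngtP j j') => // lt.
- by have := W j'; rewrite jl' lt Ac' => /(_ isT).
- by have := W' j; rewrite jl lt Ac => /(_ isT).
Qed.

(** The strict inequalities at the two cells become the weak ones at their corner (i, l), which may
    be a dot. *)
Lemma corner_pairs_adjacent n (v : 'S_n) (i j k l : 'I_n) :
  (i, j) \in opRothe v -> (k, l) \in opRothe v ->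
  k = i.+1 :> nat -> l = j.+1 :> nat ->
  ((i, j), (k, l)) \in corner_pairs v.
Proof.
move=> Dc Dc' ek el; apply/corner_pairsP; split; last 2 first.
- by move=> l'; lia.
- by move=> k'; lia.
- by split=> //; lia.
- by move: Dc Dc'; rewrite !inE /=; have := perm_val_eq v i l; lia.
Qed.

(* The remaining case, in which the cell east of (i, j) lies beyond column l and
   the cell north of (k, l) lies above row i, is contradictory: it would put
   (i, l) in the augmented diagram, between (i, j) and its east neighbour. *)
Lemma corner_pairs_dominate n (v : 'S_n) (p : ('I_n * 'I_n) * ('I_n * 'I_n)) :
  se_pair v p ->
  p \in corner_pairs v \/
  exists2 q, q \in corner_pairs v &
    (cell_dist q.1 q.2 < cell_dist p.1 p.2) && ((q.1 == p.1) || (q.2 == p.2)).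
Proof.
case: p => [[i j] [k l]] /and4P[/= Dc Dc' ik jl].
have [l1 [jl1 De W]] := next_east Dc.
have [i1 [i1k De' S]] := next_north Dc'.
have [l1l|ll1] := leqP l1 l.
(* The corner (i, l1) has west neighbour (i, j), and its south neighbour is no lower than row k
   because (k, l1) is an augmented cell. The resulting corner pair keeps (i, j) and is shorter than
   the given pair or equal to it. *)
- have Sk : (k, l1) \in augRothe v.
    by move: De Dc'; rewrite !inE /=; lia.
  have : has_south v (i, l1) by apply/existsP; exists k; rewrite ik.
  case/(next_south De) => k1 [ik1 Dk1 S1].
  have k1k : k1 <= k.
    by rewrite leqNgt; apply/negP => lt; have := S1 k; rewrite ik lt Sk => /(_ isT).
  have Hq : ((i, j), (k1, l1)) \in corner_pairs v by apply/corner_pairsP.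
  have [/andP[/eqP/val_inj ek /eqP/val_inj el]|ne] :=
    boolP ((k1 == k :> nat) && (l1 == l :> nat)); first by left; rewrite -ek -el.
  by right; exists ((i, j), (k1, l1)); rewrite // eqxx andbT /cell_dist /=; lia.
have [ii1|i1i] := leqP i i1.
- have Wj : (i1, j) \in augRothe v.
    by move: De' Dc; rewrite !inE /=; lia.
  have : has_west v (i1, l) by apply/existsP; exists j; rewrite jl.
  case/(next_west De') => j1 [j1l Dj1 W1].
  have jj1 : j <= j1.
    by rewrite leqNgt; apply/negP => lt; have := W1 j; rewrite lt jl Wj => /(_ isT).
  have Hq : ((i1, j1), (k, l)) \in corner_pairs v by apply/corner_pairsP.
  have [/andP[/eqP/val_inj ei /eqP/val_inj ej]|ne] :=
    boolP ((i1 == i :> nat) && (j1 == j :> nat)); first by left; rewrite -ei -ej.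
  by right; exists ((i1, j1), (k, l)); rewrite // eqxx orbT andbT /cell_dist /=; lia.
have := W l; rewrite jl ll1 => /(_ isT) /negP[].
by move: De De'; rewrite !inE /=; lia.
Qed.

(** By [corner_pairs_dominate], a pair that is not a corner pair is blocked by a strictly shorter
    corner pair, which is already present by induction. A corner pair is determined by either of its
    cells, so no shorter one blocks it. *)
Lemma Pv_lt_corner n (v : 'S_n) (d : nat) :
  Pv_lt v d = [set p in corner_pairs v | cell_dist p.1 p.2 < d].
Proof.
elim: d => [|d IHd] /=; first by apply/setP=> p; rewrite !inE ltn0 andbF.
apply/setP=> p; rewrite IHd in_setU.
rewrite [p \in [set q in corner_pairs v | cell_dist q.1 q.2 < d]]inE.
rewrite [p \in [set q in corner_pairs v | _ < d.+1]]inE ltnS [in RHS]leq_eqVlt.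
rewrite [in RHS]andb_orr orbC; congr (_ || _); rewrite [LHS]inE; apply/and3P/andP.
- case=> Sp /eqP dist Hp; split; last exact/eqP.
  case/orP: Hp => [/andP[]|].
    case: p Sp {dist} => [[i j] [k l]] /and4P[/= Dc Dc' _ _] /eqP ek /eqP el.
    exact: corner_pairs_adjacent.
  case: (corner_pairs_dominate Sp) => // -[q Hq /andP[dq same]] /existsP[].
  by exists q; rewrite inE Hq -dist dq.
- case=> Hp /eqP dist; split; last 2 first.
  + exact/eqP.
  + apply/orP; right; apply/existsP => -[q /andP[]].
    rewrite inE => /andP[Hq dq] /orP[] /eqP same.
    * by move: dq; rewrite (corner_pairs_fst Hq Hp same) dist ltnn.
    * by move: dq; rewrite (corner_pairs_snd Hq Hp same) dist ltnn.
  + by move: Hp; rewrite inE => /and4P[].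
Qed.

Lemma Pv_corner n (v : 'S_n) : Pv v = corner_pairs v.
Proof.
rewrite /Pv Pv_lt_corner; apply/setP=> p; rewrite inE andb_idr // => _.
case: p => [[i j] [k l]]; rewrite /cell_dist /=.
by have := (ltn_ord k, ltn_ord l); case; lia.
Qed.

(** * Counting the cells of the augmented diagram *)

Lemma card_augRothe n (v : 'S_n) : #|augRothe v| = #|opRothe v| + n.
Proof.
rewrite -(cardsID (opRothe v)); congr addn.
  by apply: eq_card => -[i j]; rewrite in_setI opRothe_aug andbA andbb.
have -> : augRothe v :\: opRothe v = [set (v j, j) | j : 'I_n].
  apply/setP=> -[i j]; rewrite in_setD opRothe_aug; apply/idP/imsetP.
  - move=> H; exists j => //; congr pair; apply: val_inj; move: H => /=; lia.
  - by case=> j' _ [-> ->]; rewrite inE /= permK; lia.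
by rewrite card_imset ?card_ord // => j j' [].
Qed.

Lemma card_no_west n (v : 'S_n) :
  #|[set e in augRothe v | ~~ has_west v e]| = n.
Proof.
set A := [set e in _ | _].
have injA : {in A &, injective fst}.
  case=> [i l] [i' l']; rewrite !inE => /andP[De W] /andP[De' W'] /= ?; subst i'.
  congr pair; apply: val_inj; case: (ltngtP l l') => //= lt.
  - by case/existsP: W'; exists l; rewrite lt inE.
  - by case/existsP: W; exists l'; rewrite lt inE.
rewrite -(card_in_imset injA); have -> : fst @: A = setT; last first.
  by rewrite cardsT card_ord.
apply/setP=> i; rewrite in_setT; apply/imsetP.
have : (i, (v^-1)%g i) \in augRothe v by rewrite inE /= permKV !leqnn.
case/(@ord_least n (fun l => (i, l) \in augRothe v)) => l Dl minl.
exists (i, l) => //; rewrite inE Dl; apply/existsP => -[j /andP[jl Dj]].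
by have := minl j Dj; move: jl => /=; lia.
Qed.

Lemma no_south_inj n (v : 'S_n) :
  {in [set e in augRothe v | ~~ has_south v e] &, injective snd}.
Proof.
case=> [i l] [i' l']; rewrite !inE => /andP[De S] /andP[De' S'] /= ?; subst l'.
congr pair; apply: val_inj; case: (ltngtP i i') => //= lt.
- by case/existsP: S; exists i'; rewrite lt inE.
- by case/existsP: S'; exists i; rewrite lt inE.
Qed.

Lemma card_no_south n (v : 'S_n) :
  #|[set e in augRothe v | ~~ has_south v e]| = n.
Proof.
rewrite -(card_in_imset (@no_south_inj n v)).
set A := [set e in _ | _]; have -> : snd @: A = setT; last first.
  by rewrite cardsT card_ord.
apply/setP=> l; rewrite in_setT; apply/imsetP.
have : (v l, l) \in augRothe v by rewrite inE /= permK !leqnn.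
case/(@ord_greatest n (fun i => (i, l) \in augRothe v)) => i Di maxi.
exists (i, l) => //; rewrite inE Di; apply/existsP => -[k /andP[ik Dk]].
by have := maxi k Dk; move: ik => /=; lia.
Qed.

Lemma card_corner_pairs n (v : 'S_n) :
  #|corner_pairs v| = #|[set e in augRothe v | has_west v e && has_south v e]|.
Proof.
rewrite -(card_in_imset (@corner_inj n v)); apply: eq_card => -[i l].
rewrite [RHS]inE; apply/imsetP/and3P.
- case=> -[[i' j] [k l']] /corner_pairsP[[Dc Dc' ik jl] De _ _] [? ?]; subst i' l'.
  split=> //; apply/existsP.
  + by exists j; rewrite jl (aug_row jl De).
  + by exists k; rewrite ik (aug_col ik De).
- case=> De /(next_west De)[j [jl Dc W]] /(next_south De)[k [ik Dc' S]].
  by exists ((i, j), (k, l)) => //; apply/corner_pairsP.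
Qed.

(** For e = (i, l), having no W e means v j > i for all j < l, and having no S e means v k <= i for
    all k >= l. So the column l of such a cell is a cut. *)
Lemma card_skew_cuts n (v : 'S_n) :
  #|[set e in augRothe v | ~~ has_west v e && ~~ has_south v e]| = #|skew_cuts v|.
Proof.
set A := [set e in _ | _].
have injA : {in A &, injective snd}.
  by apply: sub_in2 (@no_south_inj n v) => e; rewrite !inE => /and3P[-> _ ->].
rewrite -(card_in_imset injA); apply: eq_card => l.
rewrite [RHS]inE; apply/imsetP/forallP.
- case=> -[i l'] He /= ? j; subst l'; apply/forallP=> k; apply/implyP=> /andP[jl lk].
  move: He; rewrite inE => /and3P[De /existsPn W /existsPn S].
  have := W j; have := S (v k); move: De jl lk; rewrite !inE /= permK.
  by have := perm_val_eq v k l; have := perm_val_eq v i j; lia.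
- move=> cut.
  (* Conversely, the row for a cut l is the largest value at positions from l on. *)
  case: (@ord_greatest n (fun i => l <= (v^-1)%g i) (v l)) => [|i li maxi].
    by rewrite permK.
  have vl : v l <= i by apply: maxi; rewrite permK.
  exists (i, l) => //; rewrite inE; apply/and3P; split.
  + by rewrite inE /= vl.
  + apply/existsP=> -[j]; rewrite inE /= => /and3P[jl vj _].
    have /forallP/(_ ((v^-1)%g i)) := cut j.
    by rewrite jl li permKV /=; lia.
  + apply/existsP=> -[k]; rewrite inE /= => /and3P[ik _ lk].
    by have := maxi k lk; lia.
Qed.

(** Inclusion-exclusion on the cells lacking a west or a south neighbour: |D| + n = |corner pairs| +
    (n + n - |cuts|). *)
Lemma card_opRothe_corner n (v : 'S_n) :
  #|opRothe v| + #|skew_cuts v| = #|corner_pairs v| + n.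
Proof.
pose W := [set e in augRothe v | ~~ has_west v e].
pose S := [set e in augRothe v | ~~ has_south v e].
have eI : W :&: S = [set e in augRothe v | ~~ has_west v e && ~~ has_south v e].
  by apply/setP=> e; rewrite !inE; lia.
have eD : augRothe v :\: (W :|: S) =
    [set e in augRothe v | has_west v e && has_south v e].
  by apply/setP=> e; rewrite !inE; lia.
have sub : augRothe v :&: (W :|: S) = W :|: S.
  by apply/setP=> e; rewrite !inE; lia.
have := cardsID (W :|: S) (augRothe v); have := cardsUI W S.
rewrite sub eI eD -card_corner_pairs card_skew_cuts card_augRothe.
by rewrite card_no_west card_no_south; lia.
Qed.

(** * The graph of noninversions and its components *)

Lemma graph_noninversion n (v w : 'S_n) :
  (forall c : 'I_n * 'I_n, ~~ unexpected_zero v w c) ->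
  forall a b, graph_vw v w a b = (a < b) && ((v^-1)%g a < (v^-1)%g b).
Proof.
move=> nz a b; apply/existsP/andP.
- case=> -[i j]; rewrite inE /= => /andP[/andP[vj jv]].
  by case/and3P=> /eqP -> /eqP -> _; rewrite permK.
(* The two inequalities put the cell (b, [v^-1] a) in D; since it is not an unexpected zero, the
   Bruhat condition holds. *)
- case=> ab pab; exists (b, (v^-1)%g a); rewrite inE /= permKV ab pab !eqxx /=.
  have := nz (b, (v^-1)%g a).
  by rewrite /unexpected_zero inE /= permKV ab pab negbK.
Qed.

Lemma card_graph n (v w : 'S_n) :
  (forall c : 'I_n * 'I_n, ~~ unexpected_zero v w c) ->
  #|[set p : 'I_n * 'I_n | graph_vw v w p.1 p.2]| = #|opRothe v|.
Proof.
move=> nz; have inj : injective (fun c : 'I_n * 'I_n => (v c.2, c.1)).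
  by case=> [i j] [i' j'] [/perm_inj -> ->].
rewrite -[RHS](card_imset _ inj); apply: eq_card => -[a b].
rewrite inE graph_noninversion //=; apply/andP/imsetP.
- by case=> ab pab; exists (b, (v^-1)%g a); rewrite ?inE /= permKV // ab.
- by case=> -[i j]; rewrite inE /= => /andP[vj jv] [-> ->]; rewrite permK.
Qed.

(** Sending a cut l to the component of v l is a bijection. *)
Lemma n_comp_graph n (v w : 'S_n) :
  (forall c : 'I_n * 'I_n, ~~ unexpected_zero v w c) ->
  n_comp (underlying (graph_vw v w)) 'I_n = #|skew_cuts v|.
Proof.
move=> nz; set e := underlying _.
have eE a b : e (v a) (v b) = (v a < v b) && (a < b) || (v b < v a) && (b < a).
  by rewrite /e /underlying !graph_noninversion // !permK.
have sym : connect_sym e by apply: sym_connect_sym => x y; exact: orbC.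
have cutP l : l \in skew_cuts v -> forall j k : 'I_n, j < l <= k -> v k < v j.
  by rewrite inE => /forallP cut j k; move/forallP: (cut j) => /(_ k)/implyP.
(* No edge crosses the cut l', so the values at positions before l' form a union of components. *)
have sep (l l' : 'I_n) :
  l' \in skew_cuts v -> l < l' -> ~~ connect e (v l) (v l').
  move=> /cutP cut ll'; apply/negP.
  have cl : closed e [pred x | (v^-1)%g x < l'].
    apply: (intro_closed sym) => x y; rewrite -(permKV v x) -(permKV v y).
    rewrite eE /in_mem /= !permK => exy xl; rewrite ltnNge; apply/negP=> ly.
    have := cut ((v^-1)%g x) ((v^-1)%g y); move: exy; lia.
  by move/(closed_connect cl); rewrite /in_mem /= !permK ll' ltnn.
have inj : {in skew_cuts v &, injective (fun l => root e (v l))}.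
  move=> l l' Hl Hl' /eqP; rewrite (root_connect sym) => con.
  apply: val_inj; case: (ltngtP l l') => //= lt.
  - by move: con; rewrite (negPf (sep _ _ Hl' lt)).
  - by move: con; rewrite sym (negPf (sep _ _ Hl lt)).
rewrite -(card_in_imset inj); apply: eq_card => x.
rewrite !inE andbT; apply/idP/imsetP; last by case=> l _ ->; exact: roots_root.
(* The least position in a connected component is a cut. *)
move=> rx; have : connect e x (v ((v^-1)%g x)) by rewrite permKV.
case/(@ord_least n (fun l => connect e x (v l))) => l con minl.
exists l; last by rewrite -(rootP sym con); apply/esym/eqP.
rewrite inE; apply/forallP=> j; apply/forallP=> k; apply/implyP=> /andP[jl lk].
(* By minimality v j is outside the component, so v l < v j. If v k is in the component, then k and
   j form an inversion as well; otherwise k and l do, and v k < v l < v j. *)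
have nj : ~~ connect e x (v j) by apply/negP=> /minl; lia.
have nlj : ~~ e (v l) (v j).
  by apply: contra nj => elj; apply: connect_trans con (connect1 elj).
have nlk : connect e x (v k) || ~~ e (v l) (v k).
  case: (boolP (e (v l) (v k))) => elk; rewrite ?orbT // orbF.
  exact: connect_trans con (connect1 elk).
have nkj : ~~ connect e x (v k) || ~~ e (v k) (v j).
  rewrite -negb_and; apply: contra nj => /andP[ck ekj].
  exact: connect_trans ck (connect1 ekj).
have vinj a b : (nat_of_ord (v a) == v b) = (nat_of_ord a == b).
  by apply/eqP/eqP=> [/val_inj/perm_inj ->|/val_inj ->].
have := (vinj j k, vinj l k, vinj l j); move: nlj nlk nkj; rewrite !eE.
by case: (connect e x (v k)) => ? ? ? [[]]; lia.
Qed.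

Theorem theorem4p7 (n : nat) (v w : 'S_n)
    (no_unexpected_zero : forall c : 'I_n * 'I_n, ~~ unexpected_zero v w c) :
  cyclomatic (graph_vw v w) = Posz #|Pv v|.
Proof.
rewrite /cyclomatic card_graph // n_comp_graph // card_ord Pv_corner.
by have := card_opRothe_corner v; lia.
Qed.
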